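(* Let $w=abaab$, and for an interval $I\subset\mathbb{R}$ let $\Gamma(I)=\{(x,\mathrm{fr}_w(x)) : x\in I\cap\mathbb{Q}\}$ be the graph of the fringe length function over $I$. Let $\Delta_1=(0,1/3)$, $\Delta_2=(1/3,1/2)$, $\Delta_3=(1/2,2/3)$, $\Delta_4=(2/3,1)$. Decompose (up to the common endpoint $1/4$) $\Delta_1$ into $I_{1,1}=(0,1/4)$ and $I_{1,2}=(1/4,1/3)$, and let $I_{2,1}=\Delta_2=(1/3,1/2)$. Then: (i) the map $T_{1,1}(x,y)=\left(\frac{x}{1-3x},\frac{y}{1-3x}\right)$ maps $\Gamma(I_{1,1})$ bijectively onto $\Gamma((0,1))$; (ii) the map $T_{1,2}(x,y)=\left(\frac{4x-1}{9x-2},\frac{y}{9x-2}\right)$ maps $\Gamma(I_{1,2})$ bijectively onto $\Gamma(\Delta_1)$; (iii) the map $T_{2,1}(x,y)=\left(\frac{1-2x}{2-3x},\frac{y}{2-3x}\right)$ maps $\Gamma(I_{2,1})$ bijectively onto $\Gamma(\Delta_1)$; (iv) $\Gamma((0,1))$ is invariant under the reflection $\rho(x,y)=(1-x,y)$, and hence there is a similar decomposition for $\Delta_3$ and $\Delta_4$: the maps $\rho\circ T_{1,1}\circ\rho$, $\rho\circ T_{1,2}\circ\rho$, $\rho\circ T_{2,1}\circ\rho$ map $\Gamma((3/4,1))$, $\Gamma((2/3,3/4))$, $\Gamma(\Delta_3)$ bijectively onto $\Gamma((0,1))$, $\Gamma(\Delta_4)$, $\Gamma(\Delta_4)$ resp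ectively.
   Context: $\mathrm{Homeo}_+^\sim(S^1)$ is the group of orientation-preserving homeomorphisms of $\mathbb{R}$ commuting with the translation $x\mapsto x+1$. For $f\in \mathrm{Homeo}_+^\sim(S^1)$, the (real-valued) rotation number is $\mathrm{rot}^\sim(f)=\lim_{n\to\infty} f^n(0)/n\in\mathbb{R}$. $F$ is the free group on $a,b$. A word $w\in F$ is positive if it lies in the semigroup generated by $a$ and $b$ (only positive powers occur); $h_a(w)$ and $h_b(w)$ denote the numbers of $a$'s and $b$'s in $w$. For $r,s\in\mathbb{R}$, $R(w;r,s)$ is the maximum of $\mathrm{rot}^\sim(\rho(w))$ over all homomorphisms $\rho:F\to\mathrm{Homeo}_+^\sim(S^1)$ with $\mathrm{rot}^\sim(\rho(a))=r$ and $\mathrm{rot}^\sim(\rho(b))=s$ (the maximum is known to be attained). It is known (Calegari-Walker) that for $w$ positive and not a power of $a$ or $b$, and $r$ rational, there is a least rational number $s\in[0,1)$ such that $R(w;r,t)=h_a(w)r+h_b(w)$ for all $t\in[s,1)$. The fringe length of $r$ is $\mathrm{fr}_w(r):=1-s$. *)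

(* Defs.v *)
From HB Require Import structures.
From mathcomp Require Import all_boot all_order all_algebra.
From mathcomp Require Import all_classical all_reals all_analysis.

Set Implicit Arguments.
Unset Strict Implicit.
Unset Printing Implicit Defensive.

Import Order.TTheory GRing.Theory Num.Theory.
Import numFieldNormedType.Exports.

Local Open Scope classical_set_scope.
Local Open Scope ring_scope.

(* The free group F on a and b is realized as the set of reduced words.  In a
   letter (g, e), g tells the generator (true for a, false for b) and e its
   exponent (true for +1, false for -1). *)
Definition letter : Type := (bool * bool)%type.

Definition linv (x : letter) : letter := (x.1, ~~ x.2).

Definition reduced (u : seq letter) : bool :=
  sorted (fun x y => y != linv x) u.

(* Multiplies the reduced word u by x on the left, cancelling if needed. *)
Definition redcons (x : letter) (u : seq letter) : seq letter :=
  if u is y :: u' then if y == linv x then u' else x :: u else [:: x].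

Definition reduce (u : seq letter) : seq letter := foldr redcons [::] u.

Lemma linvK : involutive linv.
Proof. by case=> g e; rewrite /linv /= negbK. Qed.

Lemma reduced_behead x u : reduced (x :: u) -> reduced u.
Proof. exact: path_sorted. Qed.

Lemma reduced_redcons x u : reduced u -> reduced (redcons x u).
Proof.
case: u => [//|y u] ru /=; case: ifPn => [_|yx]; first exact: reduced_behead ru.
by rewrite /reduced /= yx.
Qed.

Lemma reduced_foldr u v : reduced v -> reduced (foldr redcons v u).
Proof. by move=> rv; elim: u => //= x u; exact: reduced_redcons. Qed.

Lemma reduced_reduce u : reduced (reduce u).
Proof. exact: reduced_foldr. Qed.

Lemma redconsK x u : reduced u -> redcons x (redcons (linv x) u) = u.
Proof.
case: u => [_|y u]; first by rewrite /= eqxx.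
move=> ru /=; rewrite linvK; case: eqP => [yx|_]; last by rewrite /= eqxx.
case: u ru => [|z u] /=; first by rewrite yx.
by rewrite /reduced /= yx => /andP[/negPf ->].
Qed.

Lemma reduce_id u : reduced u -> reduce u = u.
Proof.
elim: u => //= x u IHu ru; rewrite IHu; last exact: reduced_behead ru.
by case: u ru {IHu} => //= y u /andP[/negPf ->].
Qed.

Lemma foldr_reduce u v : reduced v ->
  foldr redcons v (reduce u) = foldr redcons v u.
Proof.
move=> rv; elim: u => //= x u <-.
case: (reduce u) => [//|y t] /=; case: eqP => // ->.
by rewrite redconsK //; exact: reduced_foldr.
Qed.

Lemma reduce_cat u v : reduce (u ++ v) = foldr redcons (reduce v) u.
Proof. exact: foldr_cat. Qed.

Lemma reduce_catl u v : reduce (reduce u ++ v) = reduce (u ++ v).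
Proof. by rewrite !reduce_cat foldr_reduce //; exact: reduced_reduce. Qed.

Lemma reduce_catr u v : reduce (u ++ reduce v) = reduce (u ++ v).
Proof. by rewrite !reduce_cat (reduce_id (reduced_reduce v)). Qed.

Definition winv (u : seq letter) : seq letter := rev (map linv u).

Lemma winvK : involutive winv.
Proof.
move=> u; rewrite /winv map_rev revK -map_comp -[RHS]map_id.
by apply: eq_map => x; exact: linvK.
Qed.

Lemma reduce_winv u : reduce (u ++ winv u) = [::].
Proof.
elim: u => //= x u IHu; rewrite /winv /= rev_cons -cats1 catA reduce_cat.
by rewrite -foldr_reduce // IHu /= eqxx.
Qed.

Record F2 : Type := MkF2 { word :> seq letter; _ : reduced word }.

HB.instance Definition _ := [isSub for word].
HB.instance Definition _ := [Choice of F2 by <:].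

Lemma wordP (u : F2) : reduced u.
Proof. exact: valP. Qed.

Definition F2_of (u : seq letter) : F2 := MkF2 (reduced_reduce u).
Definition F2_one : F2 := F2_of [::].
Definition F2_mul (u v : F2) : F2 := F2_of (u ++ v).
Definition F2_inv (u : F2) : F2 := F2_of (winv u).

Lemma F2_mulA : associative F2_mul.
Proof. by move=> u v w; apply/val_inj; rewrite /= reduce_catl reduce_catr catA. Qed.

Lemma F2_mul1 : left_id F2_one F2_mul.
Proof. by move=> u; apply/val_inj; rewrite /= reduce_id ?wordP. Qed.

Lemma F2_mulr1 : right_id F2_one F2_mul.
Proof. by move=> u; apply/val_inj; rewrite /= cats0 reduce_id ?wordP. Qed.

Lemma F2_mulV : left_inverse F2_one F2_inv F2_mul.
Proof.
move=> u; apply/val_inj; rewrite /= reduce_catl.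
by rewrite -[X in _ ++ X]winvK reduce_winv.
Qed.

Lemma F2_mulrV : right_inverse F2_one F2_inv F2_mul.
Proof. by move=> u; apply/val_inj; rewrite /= reduce_catr reduce_winv. Qed.

HB.instance Definition _ :=
  isGroup.Build F2 F2_mulA F2_mul1 F2_mulr1 F2_mulV F2_mulrV.

Definition F2_a : F2 := F2_of [:: (true, true)].
Definition F2_b : F2 := F2_of [:: (false, true)].

(* Exponent -1 letters are ignored: these are the counts for positive words. *)
Definition h_a (w : F2) : nat := count_mem (true, true) (word w).
Definition h_b (w : F2) : nat := count_mem (false, true) (word w).

Definition abaab : F2 := (F2_a * F2_b * F2_a * F2_a * F2_b)%g.

Section homeo.
Variable R : realType.

(* Orientation preserving means increasing on the line. *)
Definition is_lift_homeo (f : R -> R) : Prop :=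
  [/\ exists g : R -> R,
        [/\ cancel f g, cancel g f, continuous f & continuous g],
      {homo f : x y / x < y}
    & forall x, f (x + 1) = f x + 1].

Record homeoS1 : Type :=
  MkHomeoS1 { homeo_fun :> R -> R; homeoP : is_lift_homeo homeo_fun }.

HB.instance Definition _ := gen_eqMixin homeoS1.
HB.instance Definition _ := gen_choiceMixin homeoS1.

Lemma homeo_ext (f g : homeoS1) : (f : R -> R) =1 g -> f = g.
Proof.
case: f g => [f Pf] [g Pg] /= /funext fg; rewrite fg in Pf *.
by congr MkHomeoS1; exact: Prop_irrelevance.
Qed.

Lemma is_lift_homeo_id : is_lift_homeo id.
Proof. by split=> //; exists id; split=> // x; exact: cvg_id. Qed.

Lemma is_lift_homeo_comp (f g : R -> R) :
  is_lift_homeo f -> is_lift_homeo g -> is_lift_homeo (f \o g).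
Proof.
move=> [[f' [fK f'K cf cf']] fi ft] [[g' [gK g'K cg cg']] gi gt]; split.
- exists (g' \o f'); split; [exact: can_comp | exact: can_comp | |].
  + by move=> x; apply: continuous_comp; [exact: cg | exact: cf].
  + by move=> x; apply: continuous_comp; [exact: cf' | exact: cg'].
- by move=> x y xy; apply/fi/gi.
- by move=> x; rewrite /= gt ft.
Qed.

Lemma homeo_inv_subproof (f : homeoS1) :
  exists g : R -> R, [/\ cancel f g, cancel g f & is_lift_homeo g].
Proof.
have [[g [fK gK cf cg]] fi ft] := homeoP f.
exists g; split=> //; split; first by exists f.
- move=> x y xy; rewrite ltNge; apply/negP; rewrite le_eqVlt => /orP[/eqP gyx|].
    by move: xy; rewrite -(gK x) -gyx gK ltxx.
  by move=> /fi; rewrite !gK => /(lt_trans xy); rewrite ltxx.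
- by move=> x; rewrite -{1}(gK x) -ft fK.
Qed.

Definition homeo_one : homeoS1 := MkHomeoS1 is_lift_homeo_id.
Definition homeo_mul (f g : homeoS1) : homeoS1 :=
  MkHomeoS1 (is_lift_homeo_comp (homeoP f) (homeoP g)).
Definition homeo_inv (f : homeoS1) : homeoS1 :=
  let: exist _ (And3 _ _ Pg) := cid (homeo_inv_subproof f) in MkHomeoS1 Pg.

Lemma homeo_mulA : associative homeo_mul.
Proof. by move=> f g h; exact: homeo_ext. Qed.

Lemma homeo_mul1 : left_id homeo_one homeo_mul.
Proof. by move=> f; exact: homeo_ext. Qed.

Lemma homeo_mulr1 : right_id homeo_one homeo_mul.
Proof. by move=> f; exact: homeo_ext. Qed.

Lemma homeo_mulV : left_inverse homeo_one homeo_inv homeo_mul.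
Proof.
by move=> f; apply: homeo_ext => x /=; rewrite /homeo_inv; case: cid => g [].
Qed.

Lemma homeo_mulrV : right_inverse homeo_one homeo_inv homeo_mul.
Proof.
by move=> f; apply: homeo_ext => x /=; rewrite /homeo_inv; case: cid => g [].
Qed.

HB.instance Definition _ :=
  isGroup.Build homeoS1 homeo_mulA homeo_mul1 homeo_mulr1 homeo_mulV homeo_mulrV.

Definition rot (f : homeoS1) : R :=
  lim ((iter n f 0 / n%:R) @[n --> \oo]).

(* These are attained extrema, not sup and inf; 0 is a default value used when
   there is none. *)
Definition set_max (A : set R) : R := xget 0 (A `&` ubound A).
Definition set_min (A : set R) : R := xget 0 (A `&` lbound A).

(* The quantity written R(w; r, s). *)
Definition maxrot (w : F2) (r s : R) : R :=
  set_max [set rot (phi w) | phi in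
    [set phi : {multiplicative F2 -> homeoS1} |
      rot (phi F2_a) = r /\ rot (phi F2_b) = s]].

Definition fringe_set (w : F2) (r : R) : set R :=
  [set s | [/\ rational s, 0 <= s < 1
    & forall t : R, s <= t < 1 ->
        maxrot w r t = (h_a w)%:R * r + (h_b w)%:R]].

(* Meaningful for w positive, not a power of a or b, and r rational. *)
Definition fr (w : F2) (r : R) : R := 1 - set_min (fringe_set w r).

Definition Gamma (w : F2) (I : set R) : set (R * R) :=
  [set (x, fr w x) | x in I `&` rational].

Definition T11 (p : R * R) : R * R :=
  (p.1 / (1 - 3 * p.1), p.2 / (1 - 3 * p.1)).

Definition T12 (p : R * R) : R * R :=
  ((4 * p.1 - 1) / (9 * p.1 - 2), p.2 / (9 * p.1 - 2)).

Definition T21 (p : R * R) : R * R :=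
  ((1 - 2 * p.1) / (2 - 3 * p.1), p.2 / (2 - 3 * p.1)).

Definition reflection (p : R * R) : R * R := (1 - p.1, p.2).

End homeo.

(* Main.v *)
From HB Require Import structures.
Require Import Defs.
From mathcomp Require Import all_boot all_order all_algebra.
From mathcomp Require Import all_classical all_reals all_analysis.
From mathcomp Require Import zify ring lra.

(** The theorem follows from a closed formula for the fringe length: for p/q in
    lowest terms with p, q > 0, [fr_formula] gives fr(p/q) = 1/M, where M = q if
    3 does not divide q and M = 2q/3 if it does ([b_gaps]).  Thus q fr(p/q)
    depends only on whether 3 divides q.  A Moebius map with integer matrix
    (a b; c d) of determinant 1 or -1 sends p/q to a reduced fraction of
    denominator cp + dq = q (c p/q + d), and if 3 divides c this preserves
    divisibility of the denominator by 3; hence it divides the fringe length by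
    c p/q + d ([fr_moebius]).  All maps of the theorem are of this form or are
    composed of such maps.

    To prove the formula, let A and B be the images of a and b, with
    rot A = p/q and rot B < 1, and let W be the image of abaab.  Since
    B(x) < x + 1, replacing B by the unit translation shows that
    rot W <= 3p/q + 2 ([rot_eval_abaab_le]).

    Lower bound on rot B in the case of equality.  A has an orbit which,
    together with its integer translates, can be enumerated increasingly as
    y_i, i in Z, with y_(i+q) = y_i + 1 and A(y_i) = y_(i+p)
    ([orbit_marking]).  To each point
    attach the index i of the gap [y_i, y_(i+1)) containing it.  A raises the
    index by exactly p and B by at most q, so W raises it by at most 3p + 2q,
    and equality of the rotation numbers forces some orbit of W of length q to
    lose nothing ([exists_lossless_orbit]).  Whenever B loses nothing at a point of
    gap i, B(y_(i+1)) >= y_i + 1.  Along a lossless orbit B acts in all gaps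
    when 3 does not divide q, and in two of the three classes of gaps modulo 3
    otherwise, that is, in M gaps out of each q consecutive ones; chaining the
    inequalities gives M rot B >= M - 1 ([rot_b_ge]).

    Attainment for 1 - 1/M <= rot B < 1.  In each of the M gaps choose a low
    point and a high point, such that B sends the high point of a gap at least
    as far as the low point of the same gap plus 1; this is possible when these
    gaps have length about 1/M and the remaining ones, if any, are very short
    ([exists_long_step]).  Let A permute the gaps as a rotation by p/q would,
    but push each low point up to the high point of the image gap
    ([exists_pushing]).  Then W maps high points at least to high points, with
    no loss ([rot_eval_abaab_ge]). *)

Set Implicit Arguments.
Unset Strict Implicit.
Unset Printing Implicit Defensive.

Import Order.TTheory GRing.Theory Num.Theory.
Import numFieldNormedType.Exports.

Local Open Scope classical_set_scope.
Local Open Scope ring_scope.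

(* Otherwise the identifier denotes the rotation of a sequence. *)
Local Notation rot := Defs.rot.

(** * Rotation numbers *)

Section RotationNumber.
Variable R : realType.
Implicit Types (f g : homeoS1 R) (x y : R) (n m : nat).

Lemma homeo_lt f : {mono (f : R -> R) : x y / x < y}.
Proof. by apply: leW_mono; apply: le_mono; case: (homeoP f). Qed.

Lemma homeo_le f : {mono (f : R -> R) : x y / x <= y}.
Proof. by apply: le_mono; case: (homeoP f). Qed.

Lemma homeoD1 f x : f (x + 1) = f x + 1.
Proof. by case: (homeoP f). Qed.

Lemma homeoDn f x n : f (x + n%:R) = f x + n%:R.
Proof.
elim: n x => [|n IHn] x; first by rewrite !addr0.
by rewrite -natr1 !addrA homeoD1 IHn.
Qed.

Lemma homeoDz f x (k : int) : f (x + k%:~R) = f x + k%:~R.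
Proof.
case: k => n; first exact: homeoDn.
rewrite NegzE mulrNz -[in RHS](subrK (n.+1%:~R : R) x) -[in RHS]pmulrn homeoDn.
by rewrite addrK.
Qed.

Lemma homeoXE f n x : (f ^+ n)%g x = iter n f x.
Proof. by elim: n x => [//|n IHn] x; rewrite expgS /= IHn. Qed.

Lemma iter_homeo_le f n : {mono iter n f : x y / x <= y}.
Proof. by move=> x y; rewrite -!homeoXE homeo_le. Qed.

Lemma iter_homeoDz f n x (k : int) : iter n f (x + k%:~R) = iter n f x + k%:~R.
Proof. by rewrite -!homeoXE homeoDz. Qed.

Lemma iter_homeoDn f n x (k : nat) : iter n f (x + k%:R) = iter n f x + k%:R.
Proof. exact: (iter_homeoDz f n x k). Qed.

Lemma iter_homeoD1 f n x : iter n f (x + 1) = iter n f x + 1.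
Proof. exact: (iter_homeoDz f n x 1). Qed.

(** The displacement of f is periodic, and f is increasing, so over a period
    the displacement varies by at most 1. *)
Lemma homeo_displacement f x y : `|f x - x - (f y - y)| <= 1.
Proof.
have /andP[] := floor_itv (x - y); set k := Num.floor _.
rewrite intrD /= => kl ku.
have fl : f y + k%:~R <= f x by rewrite -homeoDz homeo_le; lra.
have fu : f x <= f y + k%:~R + 1 by rewrite -homeoDz -homeoD1 homeo_le; lra.
by rewrite ler_norml; apply/andP; split; lra.
Qed.

Lemma iter_displacement f n x : `|iter n f x - x - iter n f 0| <= 1.
Proof.
by have := homeo_displacement (f ^+ n)%g x 0; rewrite !homeoXE subr0.
Qed.

(** Turns a bound on displacements that is uniform in the number of iterations
    into a comparison of rotation numbers. *)
Lemma le_mul_nat_bounded (a c : R) : (forall n, n%:R * a <= c) -> a <= 0.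
Proof.
move=> ac; rewrite leNgt; apply/negP => a0.
have c0 : 0 <= c by have := ac 0%N; rewrite mul0r.
have := archi_boundP (divr_ge0 c0 (ltW a0)).
by rewrite ltr_pdivrMr // ltNge ac.
Qed.

Lemma iter_mul_upper f n m :
  iter (m * n) f 0 <= m%:R * (iter n f 0 + 1).
Proof.
elim: m => [|m IHm]; first by rewrite mul0r.
rewrite mulSn iterD -natr1 mulrDl mul1r.
have := iter_displacement f n (iter (m * n) f 0).
by rewrite ler_norml => /andP[_]; lra.
Qed.

Lemma iter_mul_lower f n m :
  m%:R * (iter n f 0 - 1) <= iter (m * n) f 0.
Proof.
elim: m => [|m IHm]; first by rewrite mul0r.
rewrite mulSn iterD -natr1 mulrDl mul1r.
have := iter_displacement f n (iter (m * n) f 0).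
by rewrite ler_norml => /andP[]; lra.
Qed.

(** Up to a bounded error the map n |-> f^n(0) is additive.  By [iter_mul_upper]
    and [iter_mul_lower] each (f^n(0) - 1)/n is at most each (f^m(0) + 1)/m, and
    the supremum of the former separates the two families. *)
Lemma rotation_number_exists f :
  exists r : R, forall n, `|iter n f 0 - n%:R * r| <= 1.
Proof.
pose E := [set (iter n.+1 f 0 - 1) / n.+1%:R | n in [set: nat]].
have Eub m : ubound E ((iter m.+1 f 0 + 1) / m.+1%:R).
  move=> _ [n _ <-]; rewrite ler_pdivrMr // mulrAC ler_pdivlMr //.
  rewrite mulrC [leRHS]mulrC (le_trans (iter_mul_lower f n.+1 m.+1)) //.
  by rewrite mulnC iter_mul_upper.
have Esup : has_sup E.
  split; first by exists ((iter 1 f 0 - 1) / 1), 0%N.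
  by exists ((iter 1 f 0 + 1) / 1); exact: (Eub 0%N).
exists (sup E) => -[|n]; first by rewrite /= mul0r subrr normr0.
have lo : (iter n.+1 f 0 - 1) / n.+1%:R <= sup E.
  by apply: sup_upper_bound => //; exists n.
have hi : sup E <= (iter n.+1 f 0 + 1) / n.+1%:R.
  by apply: ge_sup => //; case: Esup.
move: lo hi; rewrite ler_pdivrMr // ler_pdivlMr // => lo hi.
by rewrite ler_norml; apply/andP; split; lra.
Qed.

Lemma rot_bounded f (r c : R) :
  (forall n, `|iter n f 0 - n%:R * r| <= c) -> rot f = r.
Proof.
move=> frc; apply: cvg_lim => //.
have c0 : (fun n : nat => c / n%:R) @ \oo --> (0 : R).
  rewrite -(mulr0 c); apply: cvgM; first exact: cvg_cst.
  apply/gtr0_cvgV0; last exact: cvgr_idn.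
  by near=> n; rewrite ltr0n; near: n; exact: nbhs_infty_gt.
have cn : (fun n : nat => r - c / n%:R) @ \oo --> r.
  by rewrite -[X in _ --> X]subr0; apply: cvgB => //; exact: cvg_cst.
have cp : (fun n : nat => r + c / n%:R) @ \oo --> r.
  by rewrite -[X in _ --> X]addr0; apply: cvgD => //; exact: cvg_cst.
apply: (squeeze_cvgr _ cn cp); near=> n.
have n0 : 0 < n%:R :> R by rewrite ltr0n; near: n; exact: nbhs_infty_gt.
have := frc n; rewrite ler_norml => /andP[lo hi].
rewrite ler_pdivlMr // ler_pdivrMr // mulrBl mulrDl divfK ?gt_eqF //.
by apply/andP; split; lra.
Unshelve. all: by end_near. Qed.

(** Unlike the defining limit, this is uniform in the point and in the number
    of iterations. *)
Lemma rot_bound f n x : `|iter n f x - x - n%:R * rot f| <= 2.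
Proof.
have [r fr] := rotation_number_exists f.
rewrite (rot_bounded fr); have := fr n; have := iter_displacement f n x.
by rewrite !ler_norml => /andP[? ?] /andP[? ?]; apply/andP; split; lra.
Qed.

Lemma rot_upper f n x : iter n f x <= x + n%:R * rot f + 2.
Proof. by have := rot_bound f n x; rewrite ler_norml => /andP[_]; lra. Qed.

Lemma rot_lower f n x : x + n%:R * rot f - 2 <= iter n f x.
Proof. by have := rot_bound f n x; rewrite ler_norml => /andP[]; lra. Qed.

Lemma rot_ge f (n : nat) (k : int) x :
  x + k%:~R <= iter n f x -> k%:~R <= n%:R * rot f.
Proof.
move=> fx; suff H m : x + m%:R * k%:~R <= iter (m * n) f x.
  rewrite -subr_le0; apply: (@le_mul_nat_bounded _ 2) => m.
  by have := rot_upper f (m * n) x; have := H m; rewrite natrM; lra.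
elim: m => [|m IHm]; first by rewrite mul0r addr0.
rewrite mulSnr iterD -natr1 mulrDl mul1r.
apply: (@le_trans _ _ (iter (m * n) f (x + k%:~R))).
  by rewrite iter_homeoDz; lra.
by rewrite iter_homeo_le.
Qed.

Lemma rot_le f (n : nat) (k : int) x :
  iter n f x <= x + k%:~R -> n%:R * rot f <= k%:~R.
Proof.
move=> fx; suff H m : iter (m * n) f x <= x + m%:R * k%:~R.
  rewrite -subr_le0; apply: (@le_mul_nat_bounded _ 2) => m.
  by have := rot_lower f (m * n) x; have := H m; rewrite natrM; lra.
elim: m => [|m IHm]; first by rewrite mul0r addr0.
rewrite mulSnr iterD -natr1 mulrDl mul1r.
apply: (@le_trans _ _ (iter (m * n) f (x + k%:~R))).
  by rewrite iter_homeo_le.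
by rewrite iter_homeoDz; lra.
Qed.

Lemma rot_periodic f (n : nat) (k : int) x :
  (0 < n)%N -> iter n f x = x + k%:~R -> rot f = k%:~R / n%:R.
Proof.
move=> n0 fx; have n0' : (n%:R : R) != 0 by rewrite pnatr_eq0 -lt0n.
apply: (mulfI n0'); rewrite mulrC [RHS]mulrC divfK // mulrC.
by apply/eqP; rewrite eq_le (@rot_ge f n k x) ?fx // (@rot_le f n k x) ?fx.
Qed.

Lemma translation_is_lift (c : R) : is_lift_homeo (fun x : R => x + c).
Proof.
split; last by move=> x; rewrite addrAC.
- exists (fun x => x - c); split; [exact: addrK | exact: subrK | |] => x.
    by apply: cvgD; [exact: cvg_id | exact: cvg_cst].
  by apply: cvgB; [exact: cvg_id | exact: cvg_cst].
- by move=> x y; rewrite ltrD2r.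
Qed.

Definition translation (c : R) : homeoS1 R := MkHomeoS1 (translation_is_lift c).

Lemma rot_translation (c : R) : rot (translation c) = c.
Proof.
apply: (@rot_bounded _ _ 0) => n; rewrite (_ : iter n _ _ = n%:R * c).
  by rewrite subrr normr0.
by elim: n => [|n IHn]; rewrite ?mul0r //= IHn -natr1 mulrDl mul1r.
Qed.

(** The full orbit of 0, forwards and backwards, is invariant and bounded, and
    an increasing bijection preserving a bounded set fixes its supremum. *)
Lemma homeo_fixpoint f (c : R) :
  (forall n, `|iter n f 0| <= c) -> exists x, f x = x.
Proof.
move=> fc.
have [g [fK gK _ _]] : exists g : R -> R,
    [/\ cancel f g, cancel g f, continuous f & continuous g].
  by case: (homeoP f).
pose E : set R := [set x | exists n, x = iter n f 0 \/ iter n f x = 0].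
have Esup : has_sup E.
  split; first by exists 0, 0%N; left.
  exists (c + 1) => x [n [->|xn]].
    by have := fc n; rewrite ler_norml => /andP[_]; lra.
  have := iter_displacement f n x; have := fc n.
  by rewrite xn !ler_norml => /andP[? ?] /andP[]; lra.
have Ef x : E x -> E (f x).
  case=> n [->|]; first by exists n.+1; left.
  case: n => [/= ->|n]; first by exists 1%N; left.
  by rewrite iterSr => xn; exists n; right.
have Eg x : E x -> E (g x).
  case=> n []; last by move=> xn; exists n.+1; right; rewrite iterSr gK.
  case: n => [->|n ->]; first by exists 1%N; right; rewrite /= gK.
  by rewrite iterS fK; exists n; left.
have lub x : E x -> x <= sup E by move=> Ex; exact: sup_upper_bound.
exists (sup E); apply/eqP; rewrite eq_le; apply/andP; split.
  rewrite leNgt; apply/negP => sf.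
  have gs : g (sup E) < sup E by rewrite -(homeo_lt f) gK.
  have [|x Ex] := @sup_adherent _ E (sup E - g (sup E)) _ Esup; first by lra.
  rewrite subKr -(homeo_lt f) gK => /lt_geF.
  by rewrite lub //; exact: Ef.
apply: ge_sup; first by case: Esup.
by move=> x /Eg/lub; rewrite -(homeo_le f) gK.
Qed.

Lemma iter_power_shift f (n m k : nat) x :
  iter n (translation (- k%:R) * f ^+ m : homeoS1 R)%g x
  = iter (n * m) f x - (n * k)%:R.
Proof.
elim: n => [|n IHn]; first by rewrite subr0.
rewrite iterS IHn /= homeoXE.
rewrite (_ : - (n * k)%:R = (- (n * k)%:Z)%:~R :> R); last by rewrite mulrNz.
by rewrite iter_homeoDz -iterD !mulSn natrD mulrNz -pmulrn; ring.
Qed.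

(** The homeomorphism f^q - p has rotation number 0, hence bounded orbits, and
    so a fixed point. *)
Lemma periodic_point f (p q : nat) : (0 < q)%N -> rot f = p%:R / q%:R ->
  exists x, iter q f x = x + p%:R.
Proof.
move=> q0 fpq; pose h : homeoS1 R := (translation (- p%:R) * f ^+ q)%g.
have [n|x] := @homeo_fixpoint h 2.
  have := rot_bound f (n * q) 0; rewrite iter_power_shift fpq subr0.
  have -> : (n * q)%:R * (p%:R / q%:R) = (n * p)%:R :> R; last by [].
  by rewrite !natrM; field; rewrite pnatr_eq0 -lt0n.
by rewrite /h /= homeoXE => /(canRL (subrK _)) ?; exists x.
Qed.

Lemma iter_periodic f (n p q : nat) x : iter q f x = x + p%:R ->
  iter (n * q) f x = x + (n * p)%:R.
Proof.
move=> fx; elim: n => [|n IHn]; first by rewrite addr0.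
rewrite mulSnr iterD fx.
by rewrite (iter_homeoDz f _ _ p) IHn mulSnr natrD addrA.
Qed.

Lemma lt_translation f x : rot f < 1 -> f x < x + 1.
Proof.
move=> f1; rewrite ltNge; apply/negP => /(@rot_ge f 1 1 x).
by rewrite mul1r leNgt f1.
Qed.

End RotationNumber.

(** * Enumerated periodic sets and interpolation *)

Section Markings.
Variable R : realType.

(** The increasing enumeration by Z of a discrete subset of the line that is
    invariant under the unit translation and has m points per period. *)
Definition marking (m : nat) (u : int -> R) : Prop :=
  (forall i, u i < u (i + 1)) /\ (forall i, u (i + m%:Z) = u i + 1).

Section OneMarking.
Variables (m : nat) (u : int -> R).
Hypotheses (m_gt0 : (0 < m)%N) (um : marking m u).

Lemma marking_lt : {mono u : i j / i < j}.
Proof.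
have incr (i j : int) : i < j -> u i < u j; last by apply/leW_mono/le_mono.
move=> ij; have [n ->] : exists n : nat, j = i + n.+1%:Z.
  by exists (absz (j - i - 1)%R); lia.
elim: n => [|n IHn]; first by case: um.
apply: (lt_trans IHn); rewrite -[n.+2]addn1 PoszD addrA.
by case: um.
Qed.

Lemma marking_le : {mono u : i j / i <= j}.
Proof. by apply: le_mono => i j; rewrite marking_lt. Qed.

Lemma markingDz (i k : int) : u (i + k * m%:Z) = u i + k%:~R.
Proof.
have markingDn n j : u (j + n%:Z * m%:Z) = u j + n%:~R.
  elim: n => [|n IHn]; first by rewrite mul0r !addr0.
  rewrite (_ : j + _ = j + n%:Z * m%:Z + m%:Z); last by lia.
  by rewrite um.2 IHn -addn1 PoszD intrD addrA.
case: k => n; first exact: markingDn.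
apply/eqP; rewrite NegzE mulrNz -subr_eq opprK -markingDn; apply/eqP.
by congr u; lia.
Qed.

Lemma marking_index (z : R) : exists i : int, u i <= z < u (i + 1).
Proof.
have /andP[kl ku] := floor_itv (z - u 0); set k := Num.floor _ in kl ku.
have uk : u (k * m%:Z) <= z by rewrite -[k * _]add0r markingDz; lra.
have uk1 : z < u (k * m%:Z + m%:Z).
  by rewrite um.2 -[k * _]add0r markingDz; move: ku; rewrite intrD; lra.
have exj : exists j : nat, z < u (k * m%:Z + j%:Z + 1).
  exists m; apply: (lt_trans uk1); exact: um.1.
have := ex_minnP exj; case=> j zj minj; exists (k * m%:Z + j%:Z).
rewrite zj andbT; case: j zj minj => [|j] zj minj; first by rewrite addr0.
rewrite leNgt; apply/negP => zj'; have := minj j.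
by rewrite -addrA -PoszD addn1 => /(_ zj'); rewrite ltnn.
Qed.

Lemma marking_index_uniq (z : R) (i j : int) :
  u i <= z < u (i + 1) -> u j <= z < u (j + 1) -> i = j.
Proof.
move=> /andP[iz zi] /andP[jz zj].
have : i < j + 1 by rewrite -marking_lt; exact: le_lt_trans zj.
have : j < i + 1 by rewrite -marking_lt; exact: le_lt_trans zi.
lia.
Qed.

Definition gap_index (z : R) : int := projT1 (cid (marking_index z)).

Lemma indexP (z : R) : u (gap_index z) <= z < u (gap_index z + 1).
Proof. by rewrite /gap_index; case: cid. Qed.

Lemma index_eq (z : R) (i : int) : u i <= z < u (i + 1) -> gap_index z = i.
Proof. by move=> zi; exact: marking_index_uniq (indexP z) zi. Qed.

Lemma index_ge (z : R) (i : int) : (i <= gap_index z) = (u i <= z).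
Proof.
have /andP[iz zi] := indexP z.
apply/idP/idP => [ii|uz]; first by apply: le_trans iz; rewrite marking_le.
by rewrite -ltzD1 -marking_lt (le_lt_trans uz).
Qed.

Lemma index_le (x y : R) : x <= y -> gap_index x <= gap_index y.
Proof.
by move=> xy; rewrite index_ge (le_trans _ xy) //; case/andP: (indexP x).
Qed.

Lemma indexDz (z : R) (k : int) :
  gap_index (z + k%:~R) = gap_index z + k * m%:Z.
Proof.
apply: index_eq; have /andP[iz zi] := indexP z.
rewrite addrAC !markingDz; apply/andP; split; lra.
Qed.

End OneMarking.

(** An increasing bijection of the line is automatically bicontinuous, so no
    continuity has to be checked for maps defined piecewise. *)
Lemma monotone_bijection_is_lift (f g : R -> R) :
  cancel f g -> cancel g f -> {homo f : x y / x < y} ->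
  (forall x, f (x + 1) = f x + 1) -> is_lift_homeo f.
Proof.
move=> fK gK fi f1.
have cont (h k : R -> R) : cancel h k -> cancel k h ->
    {mono h : x y / x < y} -> {mono k : x y / x < y} -> continuous h.
  move=> hK kK hm km x; apply/cvgrPdist_lt => e e0.
  have xe : x \in `]k (h x - e), k (h x + e)[.
    by rewrite in_itv /= -{2 3}[x]hK !km; apply/andP; split; lra.
  near=> y; have : y \in `]k (h x - e), k (h x + e)[.
    by near: y; exact: near_in_itvoo xe.
  rewrite in_itv /= -[_ < y]hm -[y < _]hm !kK ltr_distlC => /andP[? ?].
  by apply/andP; split; lra.
have fm : {mono f : x y / x < y} by apply/leW_mono/le_mono.
have gm : {mono g : x y / x < y} by move=> x y; rewrite -fm !gK.
by split=> //; exists g; split=> //; [exact: cont fm gm | exact: cont gm fm].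
Unshelve. all: by end_near. Qed.

Definition interpolant (m : nat) (u v : int -> R) (m0 : (0 < m)%N)
    (um : marking m u) (x : R) : R :=
  let n := gap_index m0 um x in
  v n + (x - u n) * ((v (n + 1) - v n) / (u (n + 1) - u n)).

Lemma interpolant_in (m : nat) (u v : int -> R) (m0 : (0 < m)%N)
    (um : marking m u) (x : R) (n : int) : marking m v ->
  u n <= x < u (n + 1) ->
  interpolant v m0 um x =
    v n + (x - u n) * ((v (n + 1) - v n) / (u (n + 1) - u n)) /\
  v n <= interpolant v m0 um x < v (n + 1).
Proof.
move=> vm xn; rewrite /interpolant (index_eq m0 um xn).
have du : 0 < u (n + 1) - u n by rewrite subr_gt0; exact: um.1.
have dv : 0 < v (n + 1) - v n by rewrite subr_gt0; exact: vm.1.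
split=> //; have /andP[xl xu] := xn.
have s0 : 0 <= (x - u n) / (u (n + 1) - u n).
  by apply: divr_ge0; [lra | exact: ltW].
have s1 : (x - u n) / (u (n + 1) - u n) < 1.
  by rewrite ltr_pdivrMr //; lra.
rewrite (_ : _ * _ = (x - u n) / (u (n + 1) - u n) * (v (n + 1) - v n));
  last by ring.
by apply/andP; split; nra.
Qed.

Lemma interpolantK (m : nat) (u v : int -> R) (m0 : (0 < m)%N)
    (um : marking m u) (vm : marking m v) :
  cancel (interpolant v m0 um) (interpolant u m0 vm).
Proof.
move=> x; have xn := indexP m0 um x; set n := gap_index m0 um x in xn.
have [-> fn] := interpolant_in m0 um vm xn.
have [-> _] := interpolant_in m0 vm um fn.
have du : 0 < u (n + 1) - u n by rewrite subr_gt0; exact: um.1.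
have dv : 0 < v (n + 1) - v n by rewrite subr_gt0; exact: vm.1.
have [-> _] := interpolant_in m0 um vm xn.
field; by rewrite !gt_eqF.
Qed.

(** The inverse of an interpolant is the interpolant with the two markings
    exchanged, so bijectivity costs nothing more than [interpolantK]. *)
Lemma interpolation (m : nat) (u v : int -> R) : (0 < m)%N ->
  marking m u -> marking m v ->
  exists f : homeoS1 R, forall i, f (u i) = v i.
Proof.
move=> m0 um vm; pose F := interpolant v m0 um.
have FP x n := @interpolant_in m u v m0 um x n vm.
have Fincr : {homo F : x y / x < y}.
  move=> x y xy; have xn := indexP m0 um x; have yn := indexP m0 um y.
  have [Ex /andP[_ Fx]] := FP _ _ xn; have [Ey /andP[Fy _]] := FP _ _ yn.
  have := index_le m0 um (ltW xy); rewrite le_eqVlt => /orP[/eqP ixy|ixy].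
    rewrite /F Ex Ey ixy ltrD2l ltr_pM2r ?ltrD2r //.
    by rewrite divr_gt0 // subr_gt0; [exact: vm.1 | exact: um.1].
  apply: (lt_le_trans Fx); apply: le_trans Fy.
  by rewrite (marking_le m0 vm) -ltzD1 ltrD2r.
have F1 x : F (x + 1) = F x + 1.
  have xn := indexP m0 um x; set n := gap_index m0 um x in xn.
  have x1n : u (n + m%:Z) <= x + 1 < u (n + m%:Z + 1).
    by rewrite addrAC !um.2 lerD2r ltrD2r.
  have [Ex _] := FP _ _ xn; have [Ex1 _] := FP _ _ x1n; rewrite /F Ex Ex1.
  rewrite (_ : n + m%:Z + 1 = n + 1 + m%:Z); last by lia.
  have cancel1 (a b : R) : a + 1 - (b + 1) = a - b by ring.
  by rewrite !um.2 !vm.2 !cancel1 addrAC.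
exists (MkHomeoS1 (monotone_bijection_is_lift (interpolantK m0 um vm)
          (interpolantK m0 vm um) Fincr F1)) => i /=.
have ui : u i <= u i < u (i + 1) by rewrite lexx um.1.
by have [-> _] := FP _ _ ui; rewrite subrr mul0r addr0.
Qed.

Definition interleave (y z : int -> R) (n : int) : R :=
  if (n %% 2)%Z == 0 then y (n %/ 2)%Z else z (n %/ 2)%Z.

Lemma interleave_even y z i : interleave y z (i * 2) = y i.
Proof. by rewrite /interleave modzMl mulzK. Qed.

Lemma interleave_odd y z i : interleave y z (i * 2 + 1) = z i.
Proof.
rewrite /interleave (_ : ((i * 2 + 1) %% 2)%Z = 1) /=; last by lia.
by congr z; lia.
Qed.

Lemma interleave_marking (m : nat) (y z : int -> R) : marking m y ->
  (forall i, y i < z i < y (i + 1)) -> (forall i, z (i + m%:Z) = z i + 1) ->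
  marking (m * 2) (interleave y z).
Proof.
move=> ym yz zm.
have parity (n : int) : exists i : int, n = i * 2 \/ n = i * 2 + 1.
  by exists (n %/ 2)%Z; lia.
split=> n; have [i [->|->]] := parity n.
- by rewrite interleave_even interleave_odd; case/andP: (yz i).
- rewrite (_ : _ + 1 + 1 = (i + 1) * 2); last by lia.
  by rewrite interleave_even interleave_odd; case/andP: (yz i).
- rewrite (_ : _ + _%:Z = (i + m%:Z) * 2); last by lia.
  by rewrite !interleave_even ym.2.
- rewrite (_ : _ + _%:Z = (i + m%:Z) * 2 + 1); last by lia.
  by rewrite !interleave_odd zm.
Qed.

(** The form of interpolation used for A and B: the points y_i and the points
    z_i inside the gaps between them are prescribed different images. *)
Lemma interpolation2 (m : nat) (y z y' z' : int -> R) : (0 < m)%N ->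
  marking m y -> (forall i, y i < z i < y (i + 1)) ->
  (forall i, z (i + m%:Z) = z i + 1) ->
  marking m y' -> (forall i, y' i < z' i < y' (i + 1)) ->
  (forall i, z' (i + m%:Z) = z' i + 1) ->
  exists f : homeoS1 R, forall i, f (y i) = y' i /\ f (z i) = z' i.
Proof.
move=> m0 ym yz zm ym' yz' zm'.
have m20 : (0 < m * 2)%N by rewrite muln_gt0 m0.
have [f fE] := interpolation m20 (interleave_marking ym yz zm)
                 (interleave_marking ym' yz' zm').
exists f => i; split.
- by have := fE (i * 2); rewrite !interleave_even.
- by have := fE (i * 2 + 1); rewrite !interleave_odd.
Qed.

End Markings.

(** * Periodic orbits of a homeomorphism with rational rotation number *)

Section PeriodicOrbits.
Variable R : realType.
Implicit Types (A B : homeoS1 R).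

Lemma coprime_inverse (p q : nat) : (0 < p)%N -> coprime p q ->
  exists s k : nat, (p * s = 1 + k * q)%N.
Proof.
move=> p0 pq; have [[s k] /= sk] := coprimeP q p0 pq.
by exists s, k; lia.
Qed.

(** Let x0 satisfy A^q(x0) = x0 + p and let ps = 1 + kq.  The map G = A^s - k
    satisfies G^q(x0) = x0 + 1 and G^p(x0) = A(x0), so it advances along the
    orbit by one place; y_i = G^i(x0).  Since G^q moves x0 up, so does G, which
    makes the enumeration increasing without any discussion of the cyclic order
    of the orbit. *)
Lemma orbit_marking A (p q : nat) : (0 < p)%N -> (0 < q)%N -> coprime p q ->
  rot A = p%:R / q%:R ->
  exists y : int -> R, marking q y /\ forall i, A (y i) = y (i + p%:Z).
Proof.
move=> p0 q0 pq Apq; have [x0 Ax0] := periodic_point q0 Apq.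
have [s [k sk]] := coprime_inverse p0 pq.
pose G : homeoS1 R := (translation (- k%:R) * A ^+ s)%g.
have GE n x : iter n G x = iter (n * s) A x - (n * k)%:R.
  exact: iter_power_shift.
have Gq : iter q G x0 = x0 + 1%:R.
  rewrite GE mulnC (iter_periodic _ Ax0) -addrA -natrB; last by nia.
  by congr (_ + _%:R); nia.
have Gp : iter p G x0 = A x0.
  rewrite GE sk add1n iterS (iter_periodic _ Ax0).
  by rewrite (homeoDz A _ (k * p)%:Z) mulnC addrK.
have AG n x : A (iter n G x) = iter n G (A x).
  rewrite !GE -iterSr iterS.
  rewrite (_ : - (n * k)%:R = (- (n * k)%:Z)%:~R :> R); last by rewrite mulrNz.
  by rewrite homeoDz.
pose y (i : int) := iter (absz (i %% q)%Z) G x0 + (i %/ q)%Z%:~R.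
have yE (d : int) (n : nat) : y (d * q%:Z + n%:Z) = iter n G x0 + d%:~R.
  rewrite /y modzMDl divzMDl; last by rewrite -lt0n.
  rewrite modz_nat divz_nat absz_nat {3}(divn_eq n q) addnC iterD.
  rewrite (iter_periodic _ Gq) muln1 intrD (iter_homeoDz G _ _ (n %/ q)%N).
  by rewrite addrAC addrA.
have iE (i : int) : exists d n, i = d * q%:Z + Posz n.
  exists (i %/ q)%Z, (absz (i %% q)%Z); rewrite gez0_abs; first exact: divz_eq.
  by apply: modz_ge0; rewrite -lt0n.
have Glt : x0 < G x0.
  rewrite ltNge; apply/negP => Gx0.
  have Gn n : iter n G x0 <= x0.
    elim: n => [//|n IHn]; apply: le_trans Gx0.
    by rewrite iterS homeo_le.
  by have := Gn q; rewrite Gq; lra.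
exists y; split; first split; move=> i; have [d [n ->]] := iE i.
- rewrite (_ : _ + 1 = d * q%:Z + n.+1%:Z); last by lia.
  rewrite !yE ltrD2r iterSr ltNge -!homeoXE homeo_le -ltNge //.
- rewrite (_ : _ + q%:Z = (d + 1) * q%:Z + n%:Z); last by lia.
  by rewrite !yE intrD addrA.
- rewrite (_ : _ + p%:Z = d * q%:Z + (n + p)%:Z); last by lia.
  by rewrite !yE homeoDz AG -Gp iterD.
Qed.

End PeriodicOrbits.

(** * The upper bound for the rotation number of abaab *)

Section UpperBound.
Variable R : realType.
Implicit Types (A B : homeoS1 R).

Definition eval_abaab A B : homeoS1 R := (A * B * A * A * B)%g.

Lemma eval_abaabE A B x : eval_abaab A B x = A (B (A (A (B x)))).
Proof. by []. Qed.

Lemma rot_eval_abaab_le A B : rot B < 1 ->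
  rot (eval_abaab A B) <= 3 * rot A + 2.
Proof.
move=> B1; have Bx x : B x <= x + 1 by apply/ltW/lt_translation.
have WA x : eval_abaab A B x <= iter 3 A x + 2.
  have BA : A (B (A (A (B x)))) <= A (A (A (B x)) + 1) by rewrite homeo_le Bx.
  have AB : A (A (A (B x))) <= A (A (A (x + 1))) by rewrite !homeo_le Bx.
  by move: BA AB; rewrite eval_abaabE !homeoD1 /=; lra.
have WAn n : iter n (eval_abaab A B) 0 <= iter (n * 3) A 0 + (n * 2)%:R.
  elim: n => [|n IHn]; first by rewrite /= addr0.
  rewrite iterS mulSn iterD mulSn natrD.
  apply: (le_trans (WA _)); rewrite -(iter_homeo_le A 3) iter_homeoDn in IHn.
  by lra.
rewrite -subr_le0; apply: (@le_mul_nat_bounded _ _ 4) => n.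
have := WAn n; have := rot_lower (eval_abaab A B) n 0.
have := rot_upper A (n * 3) 0.
by rewrite !natrM; lra.
Qed.

End UpperBound.

(** * The least rotation number of b at which the bound is attained *)

(** A lossless orbit of abaab visits one gap of the orbit of a after each letter
    a, and b acts in the gaps visited at times 0 and 2 modulo 3.  This is the
    number of these gaps modulo the unit translation: all q of them if 3 does
    not divide q, and two thirds of them otherwise. *)
Definition b_gaps (q : nat) : nat := if (3 %| q)%N then (2 * (q %/ 3))%N else q.

Section LowerBound.
Variables (R : realType) (A B : homeoS1 R) (p q : nat) (y : int -> R).
Hypotheses (q_gt0 : (0 < q)%N) (yq : marking q y).
Hypothesis Ay : forall i, A (y i) = y (i + p%:Z).
Hypothesis B_lt1 : rot B < 1.

Local Notation idx := (gap_index q_gt0 yq).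
Local Notation W := (eval_abaab A B).
Let step : int := 3 * p%:Z + 2 * q%:Z.

Let spans_gap i := y i + 1 <= B (y (i + 1)).

Lemma index_a z : idx (A z) = idx z + p%:Z.
Proof.
apply: index_eq; rewrite addrAC -!Ay homeo_le homeo_lt; exact: indexP.
Qed.

Lemma index_b z : idx (B z) <= idx z + q%:Z.
Proof.
rewrite -[q%:Z]mul1r -(indexDz q_gt0 yq z 1).
by apply: index_le; apply/ltW/lt_translation.
Qed.

(** B moves no point of the gap i beyond the gap i + q, and if it reaches that
    gap then the upper end of gap i is moved at least to the lower end of gap
    i + q. *)
Lemma index_b_spans z : idx (B z) = idx z + q%:Z -> spans_gap (idx z).
Proof.
move=> Bz; rewrite /spans_gap -yq.2 -Bz.
have /andP[Bl _] := indexP q_gt0 yq (B z); apply: (le_trans Bl).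
by rewrite homeo_le ltW //; case/andP: (indexP q_gt0 yq z).
Qed.

Lemma spans_gapD i k : spans_gap (i + k * q%:Z) -> spans_gap i.
Proof.
rewrite /spans_gap addrAC !(markingDz q_gt0 yq) homeoDz addrAC.
by rewrite lerD2r.
Qed.

Lemma index_eval_abaab z : idx (W z) <= idx z + step.
Proof.
rewrite eval_abaabE index_a.
have := index_b (A (A (B z))); rewrite !index_a; have := index_b z.
by rewrite /step; lia.
Qed.

Lemma index_eval_abaab_spans z : idx (W z) = idx z + step ->
  spans_gap (idx z) /\ spans_gap (idx z + 2 * p%:Z).
Proof.
rewrite eval_abaabE index_a => Wz.
have b1 := index_b z; have b2 := index_b (A (A (B z))).
rewrite !index_a in b2.
have e1 : idx (B z) = idx z + q%:Z by move: Wz b1 b2; rewrite /step; lia.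
have e2 : idx (B (A (A (B z)))) = idx (A (A (B z))) + q%:Z.
  by move: Wz b1 b2; rewrite !index_a /step; lia.
split; first exact: index_b_spans.
have := index_b_spans e2; rewrite !index_a e1 => sp.
by apply: (@spans_gapD _ 1); move: sp; congr spans_gap; lia.
Qed.

Lemma index_iter_eval_abaab n z : idx (iter n W z) <= idx z + n%:Z * step.
Proof.
elim: n => [|n IHn]; first by rewrite mul0r addr0.
by rewrite iterS; have := index_eval_abaab (iter n W z); lia.
Qed.

Hypothesis rotW : q%:R * rot W = 3 * p%:R + 2 * q%:R.

(** If every q applications of W lost at least one index, m times q applications
    would lose m, whereas the rotation number allows only a loss bounded
    independently of m. *)
Lemma exists_lossless_orbit :
  exists z, forall n, (n <= q)%N -> idx (iter n W z) = idx z + n%:Z * step.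
Proof.
suff [z Wz] : exists z, idx z + q%:Z * step <= idx (iter q W z).
  exists z => n nq; apply/eqP; rewrite eq_le index_iter_eval_abaab andTb.
  have qE : q%:Z * step = (q - n)%N%:Z * step + n%:Z * step.
    by rewrite -mulrDl -PoszD subnK.
  have := index_iter_eval_abaab (q - n) (iter n W z); rewrite -iterD subnK //.
  by move: Wz; rewrite qE; lia.
apply: contrapT => noz.
have loss m z : idx (iter (m * q) W z) <= idx z + m%:Z * (q%:Z * step - 1).
  elim: m => [|m IHm]; first by rewrite mul0r addr0.
  rewrite mulSn iterD.
  have : ~~ (idx (iter (m * q) W z) + q%:Z * step
             <= idx (iter q W (iter (m * q) W z))).
    by apply/negP => h; apply: noz; exists (iter (m * q) W z).
  lia.
(* The rotation number leaves room for an error of 2, that is, of 2q indices. *)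
pose m := (2 * q + 1)%N.
have /(index_le q_gt0 yq) := rot_lower W (m * q) 0.
rewrite natrM -mulrA rotW -addrA.
rewrite (_ : _ - 2 = (m%:Z * step - 2)%:~R); last first.
  by rewrite intrB intrM /step intrD !intrM.
rewrite indexDz; have := loss m 0; rewrite /m; lia.
Qed.

(** Along the lossless orbit b acts at the indices i0 + n(3p + 2q) and
    i0 + n(3p + 2q) + 2p up to multiples of q.  As p is invertible modulo q,
    the multiples of 3p are, modulo q, the multiples of 3. *)
Lemma spans_gap_classes : (0 < p)%N -> coprime p q ->
  exists i0 : int, forall j : int,
    spans_gap (i0 + 3 * j) /\ spans_gap (i0 + 2 * p%:Z + 3 * j).
Proof.
move=> p0 pq; have [s [k sk]] := coprime_inverse p0 pq.
have [z zW] := exists_lossless_orbit; exists (idx z) => j.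
(* s is the inverse of p modulo q, so n * p is j modulo q. *)
pose n := absz (s%:Z * j %% q%:Z)%Z; pose e := (s%:Z * j %/ q%:Z)%Z.
have nE : s%:Z * j = e * q%:Z + n%:Z.
  rewrite gez0_abs; first exact: divz_eq.
  by apply: modz_ge0; rewrite -lt0n.
have nq : (n < q)%N.
  by rewrite -ltz_nat gez0_abs ?modz_ge0 -?lt0n // ltz_pmod.
have [] := @index_eval_abaab_spans (iter n W z).
  by rewrite -iterS !zW // 1?ltnW //; lia.
rewrite zW 1?ltnW // => s1 s2.
have jE : n%:Z * step =
    3 * j + (2 * n%:Z + 3 * (k%:Z * j) - 3 * (e * p%:Z)) * q%:Z.
  have nE' : n%:Z = s%:Z * j - e * q%:Z by rewrite nE addrC addKr.
  have sk' : p%:Z * s%:Z = 1 + k%:Z * q%:Z by rewrite -!PoszM -PoszD sk.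
  have pn : p%:Z * n%:Z = p%:Z * s%:Z * j - p%:Z * (e * q%:Z).
    by rewrite nE'; ring.
  rewrite sk' in pn.
  transitivity (3 * (p%:Z * n%:Z) + 2 * q%:Z * n%:Z).
    by rewrite /step; ring.
  by rewrite pn; ring.
split.
- apply: (@spans_gapD _ (2 * n%:Z + 3 * (k%:Z * j) - 3 * (e * p%:Z))).
  by rewrite -addrA -jE.
- apply: (@spans_gapD _ (2 * n%:Z + 3 * (k%:Z * j) - 3 * (e * p%:Z))).
  by rewrite -addrA -jE addrAC.
Qed.

(** If 3 does not divide q, every integer is a multiple of 3 modulo q, so all
    gaps are spanned.  If 3 divides q, the residues i0 and i0 + 2p modulo 3 are
    two cyclically consecutive classes c and c + 1, and the third gap is passed
    for free because y is increasing. *)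
Lemma rot_b_ge : (0 < p)%N -> coprime p q ->
  1 - 1 / (b_gaps q)%:R <= rot B.
Proof.
move=> p0 pq; have [i0 sp] := spans_gap_classes p0 pq.
have conclude (M : nat) x : (0 < M)%N -> x + M%:R <= iter M B x + 1 ->
    1 - 1 / M%:R <= rot B.
  move=> M0 Mx; have M0' : 0 < M%:R :> R by rewrite ltr0n.
  have /rot_ge : x + (M%:Z - 1)%:~R <= iter M B x by rewrite intrB -pmulrn; lra.
  rewrite intrB -pmulrn => h; rewrite -subr_ge0 -(pmulr_rge0 _ M0').
  by rewrite mulrBr mulrBr mulrCA divff ?gt_eqF // !mulr1; lra.
rewrite /b_gaps; case: ifPn => q3.
- have [c spc] : exists c : int, forall j : int, spans_gap (c + 3 * j) /\
      spans_gap (c + 1 + 3 * j).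
    have : ~~ (3 %| p)%N.
      apply/negP => p3; have : (3 %| gcdn p q)%N by rewrite dvdn_gcd p3.
      by rewrite (eqP pq).
    move=> p3; have [p1|p1] : (p %% 3 = 1)%N \/ (p %% 3 = 2)%N by lia.
      exists (i0 + 2) => j; have [_ s1] := sp (j - 2 * (p %/ 3)%N%:Z).
      have [s2 _] := sp (j + 1).
      by split; [move: s1 | move: s2]; congr spans_gap; lia.
    exists i0 => j; have [s1 _] := sp j; split=> //.
    have [_ s2] := sp (j - 2 * (p %/ 3)%N%:Z - 1).
    by move: s2; congr spans_gap; lia.
  pose m := (q %/ 3)%N; have mq : q = (3 * m)%N by rewrite /m; lia.
  apply: (conclude _ (y c)); first by lia.
  have h n : y c + (2 * n)%:R <= iter (2 * n) B (y (c + 3 * n%:Z)).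
    elim: n => [|n IHn]; first by rewrite mulr0 !addr0.
    rewrite (_ : 2 * n.+1 = (2 * n).+2)%N; last by lia.
    rewrite !iterSr.
    have [s1 s2] := spc n%:Z.
    have {}s1 : y (c + 3 * n%:Z) + 2 <= B (B (y (c + 3 * n.+1%:Z))).
      apply: (@le_trans _ _ (B (y (c + 1 + 3 * n%:Z) + 1))).
        by rewrite homeoD1 -[2]/(1 + 1) addrA lerD2r addrAC.
      rewrite homeo_le; apply: (le_trans s2); rewrite homeo_le.
      by rewrite (marking_le q_gt0 yq); lia.
    apply: (@le_trans _ _ (iter (2 * n) B (y (c + 3 * n%:Z) + 2%:R))).
      by rewrite iter_homeoDn -natr1 -natr1; lra.
    by rewrite iter_homeo_le.
  have := h m; rewrite (_ : c + 3 * m%:Z = c + q%:Z); last by lia.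
  by rewrite yq.2 iter_homeoD1.
- have all_span i : spans_gap i.
    (* 3 is invertible modulo q. *)
    have [e [j ij]] : exists e j : int, i + e * q%:Z = i0 + 3 * j.
      have [q1|q1] : (q %% 3 = 1)%N \/ (q %% 3 = 2)%N by lia.
        exists (i0 - i), (((i0 - i) * ((q %/ 3)%N%:Z))); nia.
      exists (i - i0), (((i - i0) * ((q %/ 3)%N%:Z + 1))); nia.
    by apply: (@spans_gapD _ e); rewrite ij; case: (sp j).
  apply: (conclude _ (y 0)) => //.
  have h n : y 0 + n%:R <= iter n B (y n%:Z).
    elim: n => [|n IHn]; first by rewrite addr0.
    rewrite iterSr; apply: (@le_trans _ _ (iter n B (y n%:Z + 1))).
      by rewrite iter_homeoD1 -natr1 addrA lerD2r.
    by rewrite iter_homeo_le -[n.+1]addn1 PoszD; exact: all_span.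
  by have := h q; rewrite -[q%:Z]add0r yq.2 iter_homeoD1.
Qed.

End LowerBound.

(** * Attainment of the upper bound *)

Section Attainment.
Variable R : realType.
Implicit Types (A B : homeoS1 R).

Lemma rot_marking (f : homeoS1 R) (m : nat) (u : int -> R) (k : int) :
  (0 < m)%N -> marking m u -> (forall i, f (u i) = u (i + k)) ->
  rot f = k%:~R / m%:R.
Proof.
move=> m0 um fu; apply: (@rot_periodic _ f m k (u 0) m0).
have -> n : iter n f (u 0) = u (n%:Z * k).
  elim: n => [|n IHn]; first by rewrite mul0r.
  by rewrite iterS IHn fu; congr u; lia.
by rewrite mulrC -[k * _]add0r (markingDz m0 um).
Qed.

Lemma marking_affine (m : nat) (c : R) : (0 < m)%N ->
  marking m (fun i : int => (i%:~R + c) / m%:R).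
Proof.
move=> m0; have m0' : 0 < m%:R :> R by rewrite ltr0n.
split=> i; first by rewrite ltr_pM2r ?invr_gt0 // intrD; lra.
by rewrite intrD addrAC mulrDl -pmulrn divff ?gt_eqF.
Qed.

(** In units of 1/M, B - 1 has to move j + 1 - e at least to j + e and to have
    rotation number -t.  For t < 1 the translation by -t does this.  For t = 1
    that translation moves every point too far back; but the rotation number is
    already determined by the half-integers, which are sent to the preceding
    ones, so other points may be moved back by less. *)
Lemma exists_long_step (M : nat) (t : R) : (0 < M)%N -> 0 < t <= 1 ->
  exists B, exists e : R, [/\ 0 < e < 1 / 2, rot B = 1 - t / M%:R &
    forall j : int, (j%:~R + e) / M%:R + 1 <= B ((j%:~R + (1 - e)) / M%:R)].
Proof.
move=> M0 /andP[t0]; have M0' : 0 < M%:R :> R by rewrite ltr0n.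
rewrite le_eqVlt => /orP[/eqP ->|t1]; last first.
  exists (translation (1 - t / M%:R)), ((1 - t) / 2); split; first by lra.
    exact: rot_translation.
  move=> j /=; rewrite le_eqVlt; apply/orP; left; apply/eqP; field.
  by rewrite gt_eqF.
have mono2 (a b : R) : (a / M%:R < b / M%:R) = (a < b).
  by rewrite ltr_pM2r ?invr_gt0.
have shift (c : R) (i : int) :
    ((i + M%:Z)%:~R + c) / M%:R = (i%:~R + c) / M%:R + 1.
  exact: (marking_affine c M0).2.
have [i|i||i|i|B BE] := @interpolation2 R M
    (fun i : int => (i%:~R + 1 / 2) / M%:R)
    (fun i : int => (i%:~R + 3 / 4) / M%:R)
    (fun i : int => ((i + (M%:Z - 1))%:~R + 1 / 2) / M%:R)
    (fun i : int => (i%:~R + 1 / 4) / M%:R + 1) M0 (marking_affine _ M0).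
- by rewrite !mono2 intrD; apply/andP; split; lra.
- by rewrite shift.
- have [h1 h2] := marking_affine (1 / 2) M0.
  by split=> i; [have := h1 (i + (M%:Z - 1)) | have := h2 (i + (M%:Z - 1))];
    rewrite addrAC.
- rewrite -shift !mono2 !(intrB, intrD) -!pmulrn; apply/andP; split; lra.
- by rewrite shift.
exists B, (1 / 4); split; first by lra.
  rewrite (@rot_marking B M _ (M%:Z - 1) M0 (marking_affine (1 / 2) M0)).
    by rewrite intrB -pmulrn mulrBl divff ?gt_eqF.
  by move=> i; case: (BE i).
move=> j; have [_] := BE j; rewrite (_ : 1 - 1 / 4 = 3 / 4); last by lra.
by move=> ->.
Qed.

(** The orbit y fixes the rotation number; inside the gaps A is free. *)
Lemma exists_pushing (p q : nat) (y bot top : int -> R) : (0 < q)%N ->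
  marking q y -> (forall i, y i < bot i < y (i + 1)) ->
  (forall i, y i < top i < y (i + 1)) ->
  (forall i, bot (i + q%:Z) = bot i + 1) ->
  (forall i, top (i + q%:Z) = top i + 1) ->
  exists A, rot A = p%:R / q%:R /\ forall i, A (bot i) = top (i + p%:Z).
Proof.
move=> q0 yq yb yt bq tq.
have [||i|A AE] := @interpolation2 R q y bot (fun i => y (i + p%:Z))
  (fun i => top (i + p%:Z)) q0 yq yb bq.
- by split=> i; rewrite addrAC; [exact: yq.1 | exact: yq.2].
- by move=> i; rewrite [i + 1 + _]addrAC.
- by rewrite addrAC tq.
exists A; split; last by move=> i; case: (AE i).
by rewrite [p%:R]pmulrn; apply: (rot_marking q0 yq) => i; case: (AE i).
Qed.

(** Reading abaab from the right, a high point of gap i goes to a low point of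
    the same gap under B - 1, which A lifts to the high point of gap i + p; the
    second A keeps it high, in gap i + 2p; B - 1 lowers it again and A lifts it
    to the high point of gap i + 3p.  So b acts only in the gaps i and i + 2p,
    where i ranges over a class modulo 3. *)
Lemma rot_eval_abaab_ge A B (p q : nat) (bot top : int -> R) (i0 : int) :
  (0 < q)%N -> (forall i, top (i + q%:Z) = top i + 1) ->
  (forall i, bot i <= top i) -> (forall i, A (bot i) = top (i + p%:Z)) ->
  (forall j : int, let i := i0 + 3 * j in bot i + 1 <= B (top i)
     /\ bot (i + 2 * p%:Z) + 1 <= B (top (i + 2 * p%:Z))) ->
  3 * (p%:R / q%:R) + 2 <= rot (eval_abaab A B).
Proof.
move=> q0 tq bt Ab Bt; have q0' : 0 < q%:R :> R by rewrite ltr0n.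
have At i : top (i + p%:Z) <= A (top i) by rewrite -Ab homeo_le.
have Wt j : top (i0 + 3 * (j + p%:Z)) + 2 <= eval_abaab A B (top (i0 + 3 * j)).
  have [Bt1 Bt2] := Bt j; set i := i0 + 3 * j in Bt1 Bt2.
  have AB : top (i + p%:Z) + 1 <= A (B (top i)).
    by rewrite -Ab -homeoD1 homeo_le.
  have AAB : top (i + 2 * p%:Z) + 1 <= A (A (B (top i))).
    apply: (@le_trans _ _ (A (top (i + p%:Z) + 1))); last by rewrite homeo_le.
    rewrite homeoD1 lerD2r (le_trans _ (At _)) //.
    by rewrite (_ : _ + _ + _ = i + 2 * p%:Z) //; lia.
  have BAAB : bot (i + 2 * p%:Z) + 2 <= B (A (A (B (top i)))).
    apply: (@le_trans _ _ (B (top (i + 2 * p%:Z) + 1))).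
      by rewrite homeoD1; lra.
    by rewrite homeo_le.
  rewrite eval_abaabE; apply: (@le_trans _ _ (A (bot (i + 2 * p%:Z) + 2%:R)));
    last by rewrite homeo_le.
  rewrite homeoDn Ab lerD2r (_ : _ + _ + _ = i0 + 3 * (j + p%:Z)) //.
  by rewrite /i; lia.
have Wn n : top (i0 + 3 * (n%:Z * p%:Z)) + (2 * n)%:R
    <= iter n (eval_abaab A B) (top (i0 + 3 * 0)).
  elim: n => [|n IHn]; first by rewrite mul0r !addr0.
  rewrite iterS; apply: (@le_trans _ _
    (eval_abaab A B (top (i0 + 3 * (n%:Z * p%:Z)) + (2 * n)%:R))).
    rewrite homeoDn mulnS natrD addrA lerD2r.
    by rewrite (_ : n.+1%:Z * p%:Z = n%:Z * p%:Z + p%:Z) //; lia.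
  by rewrite homeo_le.
have tqn n i : top (i + n%:Z * q%:Z) = top i + n%:R.
  elim: n => [|n IHn]; first by rewrite mul0r !addr0.
  rewrite (_ : _ + _ = i + n%:Z * q%:Z + q%:Z); last by lia.
  by rewrite tq IHn -addrA natr1.
have := Wn q.
rewrite (_ : i0 + _ = i0 + 3 * 0 + (3 * p)%N%:Z * q%:Z); last by lia.
rewrite tqn -addrA -natrD => /(@rot_ge _ _ q (3 * p + 2 * q)%N%:Z).
rewrite -pmulrn natrD !natrM => h.
rewrite -(ler_pM2l q0'); apply: le_trans h.
by rewrite le_eqVlt; apply/orP; left; apply/eqP; field; rewrite gt_eqF.
Qed.

(** A sequence prescribed on each residue class modulo 3 that grows by 2 every
    three steps: of three consecutive gaps two have length about one unit, and
    the third is negligible. *)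
Definition periodic3 (a b c : R) (i : int) : R :=
  2 * (i %/ 3)%Z%:~R +
  (if (i %% 3)%Z == 0 then a else if (i %% 3)%Z == 1 then b else c).

Lemma periodic3E a b c (e : int) :
  (periodic3 a b c (e * 3) = 2 * e%:~R + a) *
  (periodic3 a b c (e * 3 + 1) = 2 * e%:~R + b) *
  (periodic3 a b c (e * 3 + 2) = 2 * e%:~R + c).
Proof.
rewrite /periodic3.
have [-> -> ->] : [/\ ((e * 3) %/ 3)%Z = e, ((e * 3 + 1) %/ 3)%Z = e
   & ((e * 3 + 2) %/ 3)%Z = e] by split; lia.
have [-> -> ->] : [/\ ((e * 3) %% 3)%Z = 0, ((e * 3 + 1) %% 3)%Z = 1
   & ((e * 3 + 2) %% 3)%Z = 2] by split; lia.
by [].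
Qed.

Lemma periodic3D a b c (i : int) (m : nat) : (0 < m)%N ->
  periodic3 a b c (i + (3 * m)%N%:Z) / (2 * m)%:R
  = periodic3 a b c i / (2 * m)%:R + 1.
Proof.
move=> m0; rewrite /periodic3.
have [-> ->] : ((i + (3 * m)%N%:Z) %/ 3)%Z = (i %/ 3)%Z + m%:Z
   /\ ((i + (3 * m)%N%:Z) %% 3)%Z = (i %% 3)%Z by split; lia.
by rewrite intrD -pmulrn natrM; field; rewrite pnatr_eq0 -lt0n.
Qed.

(** If 3 divides q, starting from the index -p puts the action of b in the
    classes -p and p modulo 3, so that the short gaps are those of index
    divisible by 3, around the even integers in units of 1/M. *)
Lemma exists_extremal_pair (p q : nat) (t : R) : (0 < q)%N ->
  coprime p q -> 0 < t <= 1 ->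
  exists A B, [/\ rot A = p%:R / q%:R, rot B = 1 - t / (b_gaps q)%:R
    & 3 * (p%:R / q%:R) + 2 <= rot (eval_abaab A B)].
Proof.
move=> q0 pq t01; rewrite /b_gaps; case: ifPn => q3.
- pose m := (q %/ 3)%N; have qE : q = (3 * m)%N by rewrite /m; lia.
  have m0 : (0 < m)%N by lia.
  have M0 : (0 < 2 * m)%N by lia.
  have M0' : 0 < (2 * m)%:R :> R by rewrite ltr0n.
  have mono2 (a b : R) : (a / (2 * m)%:R < b / (2 * m)%:R) = (a < b).
    by rewrite ltr_pM2r ?invr_gt0.
  have [B [e [/andP[e0 e2] rB Be]]] := exists_long_step M0 t01.
  pose y i := periodic3 (- (e / 2)) (e / 2) 1 i / (2 * m)%:R.
  (* In a short gap the low and the high point coincide: b never acts there. *)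
  pose bot i := periodic3 0 e (1 + e) i / (2 * m)%:R.
  pose top i := periodic3 0 (1 - e) (2 - e) i / (2 * m)%:R.
  have split3 (i : int) :
      exists k : int, [\/ i = k * 3, i = k * 3 + 1 | i = k * 3 + 2].
    exists (i %/ 3)%Z.
    have : (i %% 3)%Z = 0 \/ (i %% 3)%Z = 1 \/ (i %% 3)%Z = 2 by lia.
    by case=> [|[|]] h; [apply: Or31 | apply: Or32 | apply: Or33]; lia.
  have next (k : int) : k * 3 + 2 + 1 = (k + 1) * 3 by lia.
  have next1 (k : int) : k * 3 + 1 + 1 = k * 3 + 2 by lia.
  have yq : marking q y.
    split=> i; last by rewrite /y {1}qE periodic3D.
    rewrite mono2; have [k [->|->|->]] := split3 i;
      rewrite ?next ?next1 !periodic3E ?intrD; lra.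
  have yb i : y i < bot i < y (i + 1).
    rewrite !mono2; have [k [->|->|->]] := split3 i;
      rewrite ?next ?next1 !periodic3E ?intrD; apply/andP; split; lra.
  have yt i : y i < top i < y (i + 1).
    rewrite !mono2; have [k [->|->|->]] := split3 i;
      rewrite ?next ?next1 !periodic3E ?intrD; apply/andP; split; lra.
  have bt i : bot i <= top i.
    rewrite ler_pM2r ?invr_gt0 //; have [k [->|->|->]] := split3 i;
      rewrite !periodic3E; lra.
  have bq i : bot (i + q%:Z) = bot i + 1 by rewrite /bot {1}qE periodic3D.
  have tq i : top (i + q%:Z) = top i + 1 by rewrite /top {1}qE periodic3D.
  have [A [rA Ab]] := exists_pushing p q0 yq yb yt bq tq.
  have Bt (i : int) : (i %% 3)%Z != 0 -> bot i + 1 <= B (top i).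
    have [k [->|->|->]] := split3 i => i3; first by lia.
      by rewrite /bot /top !periodic3E; have := Be (2 * k); rewrite intrM.
    rewrite /bot /top !periodic3E; have := Be (2 * k + 1); rewrite intrD intrM.
    by rewrite -!addrA (_ : 1 + (1 - e) = 2 - e) //; lra.
  exists A, B; split=> //.
  apply: (@rot_eval_abaab_ge A B p q bot top (- p%:Z)) => // j i.
  have p3 : ~~ (3 %| p)%N.
    apply/negP => p3; have : (3 %| gcdn p q)%N by rewrite dvdn_gcd p3.
    by rewrite (eqP pq).
  by split; apply: Bt; rewrite /i; lia.
- have q0' : 0 < q%:R :> R by rewrite ltr0n.
  have mono2 (a b : R) : (a / q%:R < b / q%:R) = (a < b).
    by rewrite ltr_pM2r ?invr_gt0.
  have [B [e [/andP[e0 e2] rB Be]]] := exists_long_step q0 t01.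
  have yq := marking_affine 0 q0.
  have bq := (marking_affine e q0).2.
  have tq := (marking_affine (1 - e) q0).2.
  have [i|i|A [rA Ab]] := exists_pushing p q0 yq _ _ bq tq.
  + by rewrite !mono2 intrD; apply/andP; split; lra.
  + by rewrite !mono2 intrD; apply/andP; split; lra.
  exists A, B; split=> //.
  apply: (@rot_eval_abaab_ge A B p q _ _ 0 q0 tq _ Ab) => [i|j i];
    last by split; exact: Be.
  by rewrite ler_pM2r ?invr_gt0 //; lra.
Qed.

End Attainment.

(** * Homomorphisms from the free group *)

Section FreeGroup.
Variables (G : groupType) (a b : G).

Definition eval_letter (l : letter) : G :=
  let g := if l.1 then a else b in if l.2 then g else (g^-1)%g.

Definition eval_seq (u : seq letter) : G :=
  foldr (fun l g => eval_letter l * g)%g 1%g u.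

Lemma eval_linv l : eval_letter (linv l) = (eval_letter l)^-1%g.
Proof. by case: l => -[] [] //=; rewrite /eval_letter /= invgK. Qed.

Lemma eval_redcons l u :
  eval_seq (redcons l u) = (eval_letter l * eval_seq u)%g.
Proof.
case: u => [//|k u] /=; case: eqP => [->|//].
by rewrite eval_linv mulgA mulgV mul1g.
Qed.

Lemma eval_foldr u v :
  eval_seq (foldr redcons v u) = (eval_seq u * eval_seq v)%g.
Proof.
elim: u => [|l u IHu] /=; first by rewrite mul1g.
by rewrite eval_redcons IHu mulgA.
Qed.

Lemma eval_reduce u : eval_seq (reduce u) = eval_seq u.
Proof. by rewrite /reduce eval_foldr mulg1. Qed.

Definition free_extension (w : F2) : G := eval_seq (word w).

Lemma free_extensionM : {morph free_extension : u v / (u * v)%g}.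
Proof.
by move=> u v; rewrite /free_extension /= reduce_cat eval_foldr eval_reduce.
Qed.

HB.instance Definition _ :=
  isMultiplicative.Build F2 G free_extension free_extensionM.

(** The universal property of the free group of rank 2. *)
Lemma free_extension_exists :
  exists phi : {multiplicative F2 -> G}, phi F2_a = a /\ phi F2_b = b.
Proof.
exists free_extension.
by rewrite /= /free_extension /= /eval_letter /= !mulg1.
Qed.

End FreeGroup.

(** * The formula for the fringe length *)

Section Fringe.
Variable R : realType.

Lemma rational_fringe_bound (M : nat) : rational (1 - 1 / M%:R : R).
Proof.
by exists (1 - 1 / M%:R) => //; rewrite rmorphB fmorph_div !rmorph1 rmorph_nat.
Qed.

Lemma h_abaab : (h_a abaab = 3)%N /\ (h_b abaab = 2)%N.
Proof. by []. Qed.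

Lemma maxrot_setE (r t : R) :
  [set rot (phi abaab) | phi in [set phi : {multiplicative F2 -> homeoS1 R} |
      rot (phi F2_a) = r /\ rot (phi F2_b) = t]]
  = [set rot (eval_abaab A B) |
      A in [set A | rot A = r] & B in [set B | rot B = t]].
Proof.
apply/seteqP; split=> [_ [phi [ra rb] <-]|_ [A rA [B rB <-]]].
  exists (phi F2_a) => //; exists (phi F2_b) => //.
  by rewrite /abaab !gmulfM.
have [phi [pa pb]] := free_extension_exists A B.
exists phi; first by rewrite /= pa pb.
by rewrite /abaab !gmulfM pa pb.
Qed.

Lemma set_max_eq (S : set R) (m : R) : S m -> ubound S m -> set_max S = m.
Proof.
move=> Sm Um; apply: xget_unique => // n [Sn Un].
by apply/eqP; rewrite eq_le Um // Un.
Qed.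

Lemma set_min_eq (S : set R) (m : R) : S m -> lbound S m -> set_min S = m.
Proof.
move=> Sm Um; apply: xget_unique => // n [Sn Un].
by apply/eqP; rewrite eq_le Um // Un.
Qed.

(** The default value of an absent maximum is 0, so a nonzero maximum is
    attained. *)
Lemma set_max_neq0 (S : set R) : set_max S != 0 -> S (set_max S).
Proof. by rewrite /set_max; case: xgetP => [m _ []|_] //; rewrite eqxx. Qed.

Lemma maxrot_extremal (p q : nat) (t : R) :
  (0 < p)%N -> (0 < q)%N -> coprime p q -> 0 <= t < 1 ->
  maxrot abaab (p%:R / q%:R) t =
    (h_a abaab)%:R * (p%:R / q%:R) + (h_b abaab)%:R
  <-> 1 - 1 / (b_gaps q)%:R <= t.
Proof.
move=> p0 q0 pq /andP[t0 t1]; have [-> ->] := h_abaab.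
have q0' : 0 < q%:R :> R by rewrite ltr0n.
have M0 : 0 < (b_gaps q)%:R :> R.
  by rewrite ltr0n /b_gaps; case: ifP => q3; lia.
rewrite /maxrot maxrot_setE; set S := (X in set_max X); split=> [SE|tM].
- have : S (3 * (p%:R / q%:R) + 2).
    by rewrite -SE; apply: set_max_neq0; rewrite SE gt_eqF // ltr_wpDl.
  case=> A rA [B rB rW]; rewrite -rB.
  have [y [yq Ay]] := orbit_marking p0 q0 pq rA.
  apply: (rot_b_ge q0 yq Ay) => //; first by rewrite rB.
  by rewrite rW; field; rewrite gt_eqF.
- have t01 : 0 < (1 - t) * (b_gaps q)%:R <= 1.
    rewrite mulr_gt0 ?subr_gt0 //=.
    by rewrite -ler_pdivlMr //; lra.
  have [A [B [rA rB rW]]] := @exists_extremal_pair R p q _ q0 pq t01.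
  rewrite mulfK ?gt_eqF // subKr in rB.
  have ub A' B' : rot A' = p%:R / q%:R -> rot B' = t ->
      rot (eval_abaab A' B') <= 3 * (p%:R / q%:R) + 2.
    by move=> <- rB'; apply: rot_eval_abaab_le; rewrite rB'.
  apply: set_max_eq; last by move=> _ [A' ? [B' ? <-]]; exact: ub.
  exists A => //; exists B => //.
  by apply/eqP; rewrite eq_le rW ub.
Qed.

Lemma fr_formula (p q : nat) : (0 < p)%N -> (0 < q)%N -> coprime p q ->
  fr abaab (p%:R / q%:R : R) = 1 / (b_gaps q)%:R.
Proof.
move=> p0 q0 pq; rewrite /fr.
have M0 : 1 <= (b_gaps q)%:R :> R.
  by rewrite ler1n /b_gaps; case: ifP => q3; lia.
have Mpos : 0 < (b_gaps q)%:R :> R by lra.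
have M1 : 1 / (b_gaps q)%:R <= 1 :> R by rewrite ler_pdivrMr // mul1r.
have M2 : 0 < 1 / (b_gaps q)%:R :> R by rewrite divr_gt0.
rewrite (@set_min_eq _ (1 - 1 / (b_gaps q)%:R)); first by rewrite subKr.
  split; [exact: rational_fringe_bound | by apply/andP; split; lra |] => t t1.
  by apply/maxrot_extremal => //; [apply/andP; split; lra | case/andP: t1].
move=> s [_ /andP[s0 s1] smax]; apply/(maxrot_extremal p0 q0 pq).
  by rewrite s0.
by apply: smax; rewrite lexx.
Qed.

Lemma b_gapsE (q : nat) :
  (b_gaps q)%:R = q%:R * (if (3 %| q)%N then 2 / 3 else 1) :> R.
Proof.
rewrite /b_gaps; case: ifP => [/dvdnP[k ->]|_]; last by rewrite mulr1.
by rewrite mulnK // !natrM; field.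
Qed.

Lemma positive_rationalP (x : R) : rational x -> 0 < x ->
  exists p q : nat, [/\ (0 < p)%N, (0 < q)%N, coprime p q & x = p%:R / q%:R].
Proof.
move=> [r _ <-]; rewrite ltr0q => r0.
exists (absz (numq r)), (absz (denq r)); split.
- by rewrite absz_gt0 gt_eqF // numq_gt0.
- by rewrite absz_gt0 denq_neq0.
- exact: coprime_num_den.
- rewrite !pmulrn !gez0_abs ?denq_ge0 ?numq_ge0 ?ltW //.
Qed.

Lemma rational_moebius (a b c d : int) (x : R) : rational x ->
  rational ((a%:~R * x + b%:~R) / (c%:~R * x + d%:~R)).
Proof.
move=> [r _ <-]; exists ((a%:~R * r + b%:~R) / (c%:~R * r + d%:~R)) => //.
by rewrite fmorph_div !rmorphD !rmorphM /= !ratr_int.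
Qed.

(** The inverse matrix is integral as well, so the numerator P and denominator
    Q of the image are coprime, and 3 divides Q if and only if it divides q. *)
Lemma fr_moebius (a b c d : int) (x : R) :
  (a * d - b * c == 1) || (a * d - b * c == -1) -> (3 %| c)%Z ->
  rational x -> 0 < x -> 0 < a%:~R * x + b%:~R -> 0 < c%:~R * x + d%:~R ->
  fr abaab ((a%:~R * x + b%:~R) / (c%:~R * x + d%:~R))
    = fr abaab x / (c%:~R * x + d%:~R).
Proof.
move=> det c3 rx x0; have [p [q [p0 q0 pq ->]]] := positive_rationalP rx x0.
have q0' : 0 < q%:R :> R by rewrite ltr0n.
have clear (u v : int) :
    u%:~R * (p%:R / q%:R) + v%:~R = (u * p%:Z + v * q%:Z)%:~R / q%:R :> R.
  by rewrite intrD !intrM -!pmulrn; field; rewrite gt_eqF.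
rewrite !clear !pmulr_lgt0 ?invr_gt0 // !ltr0z.
set P := a * _ + _; set Q := c * _ + _ => P0 Q0.
have combP : d * P - b * Q = (a * d - b * c) * p%:Z by rewrite /P /Q; ring.
have combQ : a * Q - c * P = (a * d - b * c) * q%:Z by rewrite /P /Q; ring.
have PE : P = (absz P)%:Z by rewrite gtz0_abs.
have QE : Q = (absz Q)%:Z by rewrite gtz0_abs.
have PQ : coprime (absz P) (absz Q).
  set g := gcdn (absz P) (absz Q).
  have gP : (g%:Z %| P)%Z by rewrite dvdzE dvdn_gcdl.
  have gQ : (g%:Z %| Q)%Z by rewrite dvdzE dvdn_gcdr.
  have gp : (g%:Z %| p%:Z)%Z.
    have : (g%:Z %| d * P - b * Q)%Z by rewrite rpredB // dvdz_mull.
    by rewrite combP; case/orP: det => /eqP ->; rewrite ?mul1r // mulN1r rpredN.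
  have gq : (g%:Z %| q%:Z)%Z.
    have : (g%:Z %| a * Q - c * P)%Z by rewrite rpredB // dvdz_mull.
    by rewrite combQ; case/orP: det => /eqP ->; rewrite ?mul1r // mulN1r rpredN.
  have : (g %| gcdn p q)%N by rewrite dvdn_gcd; apply/andP.
  by rewrite (eqP pq) dvdn1.
have Q3 : (3 %| absz Q)%N = (3 %| q)%N.
  have -> : (3 %| absz Q)%N = (3 %| Q)%Z by rewrite dvdzE.
  have -> : (3 %| q)%N = (3 %| q%:Z)%Z by rewrite dvdzE.
  apply/idP/idP => [Q3|q3]; last first.
    by apply: rpredD; [exact: dvdz_mulr | exact: dvdz_mull].
  have : (3 %| a * Q - c * P)%Z.
    by apply: rpredB; [exact: dvdz_mull | exact: dvdz_mulr].
  by rewrite combQ; case/orP: det => /eqP ->; rewrite ?mul1r // mulN1r rpredN.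
have Q0' : 0 < Q%:~R :> R by rewrite ltr0z.
have -> : P%:~R / q%:R / (Q%:~R / q%:R) = (absz P)%:R / (absz Q)%:R :> R.
  by rewrite !pmulrn -PE -QE; field; rewrite !gt_eqF.
rewrite !fr_formula ?absz_gt0 ?gt_eqF // !b_gapsE Q3 [(absz Q)%:R]pmulrn -QE.
by case: ifP => _; field; rewrite !gt_eqF.
Qed.

Definition moebius (a b c d : int) (z : R * R) : R * R :=
  ((a%:~R * z.1 + b%:~R) / (c%:~R * z.1 + d%:~R), z.2 / (c%:~R * z.1 + d%:~R)).

(** By [fr_moebius] the map sends the graph over I into the graph over J, so it
    is bijective as soon as the map on the first coordinates is; the inverse of
    the latter is the Moebius map of the adjugate matrix. *)
Lemma moebius_bij (a b c d : int) (I J : set R) :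
  (a * d - b * c == 1) || (a * d - b * c == -1) -> (3 %| c)%Z ->
  (forall x, I x -> [/\ 0 < x, 0 < a%:~R * x + b%:~R, 0 < c%:~R * x + d%:~R
     & J ((a%:~R * x + b%:~R) / (c%:~R * x + d%:~R))]) ->
  (forall x, J x -> a%:~R - c%:~R * x != 0 /\
     I ((d%:~R * x - b%:~R) / (a%:~R - c%:~R * x))) ->
  set_bij (Gamma abaab I) (Gamma abaab J) (moebius a b c d).
Proof.
move=> det c3 IJ JI.
have detR : a%:~R * d%:~R - b%:~R * c%:~R != 0 :> R.
  rewrite -!intrM -intrB; case/orP: det => /eqP ->; first by rewrite oner_eq0.
  by rewrite mulrNz oppr_eq0 oner_eq0.
have moebiusE x : I x -> rational x -> moebius a b c d (x, fr abaab x) =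
    ((a%:~R * x + b%:~R) / (c%:~R * x + d%:~R),
     fr abaab ((a%:~R * x + b%:~R) / (c%:~R * x + d%:~R))).
  by move=> /IJ[x0 n0 d0 _] rx; rewrite fr_moebius.
split.
- move=> _ [x [Ix rx] <-]; rewrite moebiusE //.
  have [_ _ _ Jx] := IJ x Ix; eexists; last by [].
  by split=> //; exact: rational_moebius.
- move=> _ _ /set_mem[x [Ix _] <-] /set_mem[y [Iy _] <-] [xy _].
  have [_ _ dx _] := IJ x Ix; have [_ _ dy _] := IJ y Iy.
  suff -> : x = y by [].
  have /eqP := xy; rewrite eqr_div ?(lt0r_neq0 dx) ?(lt0r_neq0 dy) // => /eqP h.
  apply/(mulfI detR)/eqP; rewrite -subr_eq0; apply/eqP.
  transitivity ((a%:~R * x + b%:~R) * (c%:~R * y + d%:~R)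
    - (a%:~R * y + b%:~R) * (c%:~R * x + d%:~R)); first by ring.
  by rewrite h subrr.
- move=> _ [x [Jx rx] <-]; have [ac Ix] := JI x Jx.
  have xE : (d%:~R * x - b%:~R) / (a%:~R - c%:~R * x) =
      (d%:~R * x + (- b)%:~R) / ((- c)%:~R * x + a%:~R).
    by rewrite !mulrNz mulNr [- _ + _]addrC.
  set x' := (d%:~R * x - b%:~R) / _ in Ix xE.
  have rx' : rational x' by rewrite xE; exact: rational_moebius.
  exists (x', fr abaab x'); first by exists x'.
  rewrite moebiusE //; have [_ _ dx _] := IJ x' Ix.
  suff -> : (a%:~R * x' + b%:~R) / (c%:~R * x' + d%:~R) = x by [].
  apply: (@mulIf _ (c%:~R * x' + d%:~R)); first by rewrite gt_eqF.
  by rewrite divfK ?gt_eqF // /x'; field.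
Qed.

Lemma T11E : @T11 R = moebius 1 0 (-3) 1.
Proof.
by apply/funext => -[x y]; rewrite /T11 /moebius /=; congr (_ / _, _ / _); ring.
Qed.

Lemma T12E : @T12 R = moebius 4 (-1) 9 (-2).
Proof.
by apply/funext => -[x y]; rewrite /T12 /moebius /=; congr (_ / _, _ / _); ring.
Qed.

Lemma T21E : @T21 R = moebius (-2) 1 (-3) 2.
Proof.
by apply/funext => -[x y]; rewrite /T21 /moebius /=; congr (_ / _, _ / _); ring.
Qed.

Lemma reflectionE : @reflection R = moebius (-1) 1 0 1.
Proof.
apply/funext => -[x y]; rewrite /reflection /moebius /=.
have -> : 0%:~R * x + 1%:~R = 1 :> R by ring.
by rewrite !divr1; congr (_, _); ring.
Qed.

End Fringe.

(** * The self-similarity of the fringe *)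

Theorem theorem5p1 (R : realType) :
  let G := @Gamma R abaab in
  let D1 : set R := `]0, (1 / 3)[%classic in
  let D2 : set R := `](1 / 3), (1 / 2)[%classic in
  let D3 : set R := `](1 / 2), (2 / 3)[%classic in
  let D4 : set R := `](2 / 3), 1[%classic in
  let I11 : set R := `]0, (1 / 4)[%classic in
  let I12 : set R := `](1 / 4), (1 / 3)[%classic in
  let I21 : set R := D2 in
  let I41 : set R := `](3 / 4), 1[%classic in
  let I42 : set R := `](2 / 3), (3 / 4)[%classic in
  let I01 : set R := `]0, 1[%classic in
  [/\ set_bij (G I11) (G I01) (@T11 R),
      set_bij (G I12) (G D1) (@T12 R),
      set_bij (G I21) (G D1) (@T21 R)
    & [/\ @reflection R @` G I01 = G I01,
          set_bij (G I41) (G I01) (@reflection R \o @T11 R \o @reflection R),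
          set_bij (G I42) (G D4) (@reflection R \o @T12 R \o @reflection R)
        & set_bij (G D3) (G D4) (@reflection R \o @T21 R \o @reflection R)]].
Proof.
move=> G D1 D2 D3 D4 I11 I12 I21 I41 I42 I01.
have itvP (u v x : R) : `]u, v[%classic x <-> u < x < v by rewrite /= in_itv.
have itv_div (u v n d : R) : 0 < d -> u * d < n -> n < v * d ->
    `]u, v[%classic (n / d).
  by move=> d0 un nv; apply/itvP; rewrite ltr_pdivlMr // un ltr_pdivrMr.
have itv_ndiv (u v n d : R) : d < 0 -> n < u * d -> v * d < n ->
    d != 0 /\ `]u, v[%classic (n / d).
  move=> d0 un nv; split; first by rewrite lt_eqF.
  by rewrite -[n / d]divrNN; apply: itv_div; lra.
have itv_pdiv (u v n d : R) : 0 < d -> u * d < n -> n < v * d ->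
    d != 0 /\ `]u, v[%classic (n / d).
  by move=> d0 un nv; split; [rewrite gt_eqF | exact: itv_div].
have h11 : set_bij (G I11) (G I01) (@T11 R).
  rewrite T11E; apply: moebius_bij => // x /itvP/andP[x0 x1].
    by split; [| | |apply: itv_div]; lra.
  by apply: itv_pdiv; lra.
have h12 : set_bij (G I12) (G D1) (@T12 R).
  rewrite T12E; apply: moebius_bij => // x /itvP/andP[x0 x1].
    by split; [| | |apply: itv_div]; lra.
  by apply: itv_pdiv; lra.
have h21 : set_bij (G I21) (G D1) (@T21 R).
  rewrite T21E; apply: moebius_bij => // x /itvP/andP[x0 x1].
    by split; [| | |apply: itv_div]; lra.
  by apply: itv_ndiv; lra.
have refl (u v u' v' : R) : 0 <= u -> v <= 1 -> u' = 1 - v -> v' = 1 - u ->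
    set_bij (G `]u, v[%classic) (G `]u', v'[%classic) (@reflection R).
  move=> u0 v1 -> ->.
  rewrite reflectionE; apply: moebius_bij => // x /itvP/andP[x0 x1].
    by split; [| | |apply: itv_div]; lra.
  by apply: itv_ndiv; lra.
have conjugate (I J I' J' : set R) T : set_bij (G I') (G I) (@reflection R) ->
    set_bij (G I) (G J) T -> set_bij (G J) (G J') (@reflection R) ->
    set_bij (G I') (G J') (@reflection R \o T \o @reflection R).
  by move=> h1 h2 h3; apply: set_bij_comp h1 _; exact: set_bij_comp h2 h3.
split=> //; split.
- have [fun01 _ surj01] : set_bij (G I01) (G I01) (@reflection R).
    by apply: refl; lra.
  by apply/seteqP; split=> // _ [z Gz <-]; exact: fun01.
- by apply: conjugate h11 _; apply: refl; lra.
- by apply: conjugate h12 _; apply: refl; lra.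
- by apply: conjugate h21 _; apply: refl; lra.
Qed.
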